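(* Let $n \geq 0$ and let $M, K \models \mathbf{PA}^-$ be such that $K$ is a cofinal extension of $M$ and $M \prec_{\Delta_0} K$. 1. If $M \models \mathbf{Coll}(\Sigma_{n+1})$, then $M \prec_{\Sigma_{n+2}} K$. 2. If $M \models \mathbf{Coll}_{\mathrm{s}}(\Sigma_{n+1})$, then $K \models \mathbf{Coll}_{\mathrm{s}}(\Sigma_{n+1})$.
   Context: $\mathcal{L}_A=\{0,1,+,\times,<\}$ is the language of first-order arithmetic, and $\mathbf{PA}^-$ is the $\mathcal{L}_A$-theory of the non-negative parts of commutative discretely ordered rings. $\Delta_0=\Sigma_0=\Pi_0$ is the class of $\mathcal{L}_A$-formulas all of whose quantifiers are bounded; $\Sigma_{n+1}$ (resp. $\Pi_{n+1}$) formulas are those of the form $\exists \vec{y}\,\varphi$ with $\varphi\in\Pi_n$ (resp. $\forall \vec{y}\,\varphi$ with $\varphi\in\Sigma_n$), where $\vec{y}$ is a finite, possibly empty, tuple. Vector notation denotes finite (possibly empty) tuples of variables or elements; for tuples of the same length, $\vec{x}<\vec{u}$ means $x_i<u_i$ for every $i$. $M\prec_\Gamma K$ means $M$ is a substructure of $K$ and for every $\vec{a}\in M$ and every $\varphi(\vec{x})\in\Gamma$, $M\models\varphi(\vec{a})$ iff $K\models\varphi(\vec{a})$. $K$ is a cofinal extension of $M$ iff $M$ is a substructure of $K$ and for every $a\in K$ there is $b\in M$ with $K\models a<b$. $\mathbf{Coll}(\Gamma)$ is the scheme $\forall \vec{z}\,\forall \vec{u}\,(\forall \vec{x}<\vec{u}\,\exists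 \vec{y}\,\varphi(\vec{x},\vec{y},\vec{z})\to\exists \vec{v}\,\forall \vec{x}<\vec{u}\,\exists \vec{y}<\vec{v}\,\varphi(\vec{x},\vec{y},\vec{z}))$ for $\varphi\in\Gamma$. $\mathbf{Coll}_{\mathrm{s}}(\Gamma)$ is the scheme $\forall \vec{z}\,\forall \vec{u}\,\exists \vec{v}\,\forall \vec{x}<\vec{u}\,(\exists \vec{y}\,\varphi(\vec{x},\vec{y},\vec{z})\to\exists \vec{y}<\vec{v}\,\varphi(\vec{x},\vec{y},\vec{z}))$ for $\varphi\in\Gamma$. *)

(* Defs.v *)
From mathcomp Require Import all_boot.

Set Implicit Arguments.
Unset Strict Implicit.
Unset Printing Implicit Defensive.

(* Syntax of L_A; variables are de Bruijn indices, and [All] and [Ex] bind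
   index 0. *)
Inductive term : Type :=
| Var of nat
| Zero
| One
| Add of term & term
| Mul of term & term.

Inductive formula : Type :=
| Eq of term & term
| Lt of term & term
| Not of formula
| And of formula & formula
| Or of formula & formula
| Imp of formula & formula
| All of formula
| Ex of formula.

Fixpoint shift (t : term) : term :=
  match t with
  | Var i => Var i.+1
  | Zero => Zero
  | One => One
  | Add s t => Add (shift s) (shift t)
  | Mul s t => Mul (shift s) (shift t)
  end.

(* The bounding term [t] is shifted, so the bound variable does not occur in
   it. *)
Definition bAll (t : term) (phi : formula) : formula :=
  All (Imp (Lt (Var 0) (shift t)) phi).
Definition bEx (t : term) (phi : formula) : formula :=
  Ex (And (Lt (Var 0) (shift t)) phi).

Inductive Delta0 : formula -> Prop :=
| Delta0_Eq s t : Delta0 (Eq s t)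
| Delta0_Lt s t : Delta0 (Lt s t)
| Delta0_Not phi : Delta0 phi -> Delta0 (Not phi)
| Delta0_And phi psi : Delta0 phi -> Delta0 psi -> Delta0 (And phi psi)
| Delta0_Or phi psi : Delta0 phi -> Delta0 psi -> Delta0 (Or phi psi)
| Delta0_Imp phi psi : Delta0 phi -> Delta0 psi -> Delta0 (Imp phi psi)
| Delta0_bAll t phi : Delta0 phi -> Delta0 (bAll t phi)
| Delta0_bEx t phi : Delta0 phi -> Delta0 (bEx t phi).

(* The quantifier block may be empty (k = 0). *)
Inductive Sigma : nat -> formula -> Prop :=
| Sigma_0 phi : Delta0 phi -> Sigma 0 phi
| Sigma_S n k phi : Pi n phi -> Sigma n.+1 (iter k Ex phi)
with Pi : nat -> formula -> Prop :=
| Pi_0 phi : Delta0 phi -> Pi 0 phi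
| Pi_S n k phi : Sigma n phi -> Pi n.+1 (iter k All phi).

Record structure : Type := Structure {
  carrier :> Type;
  zero : carrier;
  one : carrier;
  add : carrier -> carrier -> carrier;
  mul : carrier -> carrier -> carrier;
  lt : carrier -> carrier -> Prop
}.

Arguments zero {s}.
Arguments one {s}.
Arguments add {s}.
Arguments mul {s}.
Arguments lt {s}.

(* [cat_env s e] assigns the entries of [s] to the variables 0, ...,
   size s - 1 and [e i] to the variable size s + i. *)
Definition cat_env (T : Type) (s : seq T) (e : nat -> T) : nat -> T :=
  fun i => nth (e (i - size s)) s i.

Fixpoint eval (M : structure) (e : nat -> M) (t : term) : M :=
  match t with
  | Var i => e i
  | Zero => zero
  | One => one
  | Add s t => add (eval e s) (eval e t)
  | Mul s t => mul (eval e s) (eval e t)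
  end.

Fixpoint sat (M : structure) (e : nat -> M) (phi : formula) : Prop :=
  match phi with
  | Eq s t => eval e s = eval e t
  | Lt s t => lt (eval e s) (eval e t)
  | Not phi => ~ sat e phi
  | And phi psi => sat e phi /\ sat e psi
  | Or phi psi => sat e phi \/ sat e psi
  | Imp phi psi => sat e phi -> sat e psi
  | All phi => forall a : M, sat (cat_env [:: a] e) phi
  | Ex phi => exists a : M, sat (cat_env [:: a] e) phi
  end.

(* The usual axioms (as in Kaye, "Models of Peano Arithmetic", Chapter 2) for
   the theory of the non-negative parts of commutative discretely ordered
   rings. *)
Record PAminus (M : structure) : Prop := {
  PA_addA : forall x y z : M, add (add x y) z = add x (add y z);
  PA_addC : forall x y : M, add x y = add y x;
  PA_mulA : forall x y z : M, mul (mul x y) z = mul x (mul y z);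
  PA_mulC : forall x y : M, mul x y = mul y x;
  PA_mulDr : forall x y z : M, mul x (add y z) = add (mul x y) (mul x z);
  PA_addr0 : forall x : M, add x zero = x;
  PA_mulr0 : forall x : M, mul x zero = zero;
  PA_mulr1 : forall x : M, mul x one = x;
  PA_lt_trans : forall x y z : M, lt x y -> lt y z -> lt x z;
  PA_lt_irrefl : forall x : M, ~ lt x x;
  PA_lt_total : forall x y : M, lt x y \/ x = y \/ lt y x;
  PA_lt_add : forall x y z : M, lt x y -> lt (add x z) (add y z);
  PA_lt_mul : forall x y z : M, lt zero z -> lt x y -> lt (mul x z) (mul y z);
  PA_lt_sub : forall x y : M, lt x y -> exists z : M, add x z = y;
  PA_lt01 : lt (zero : M) one;
  PA_discrete : forall x : M, lt zero x -> one = x \/ lt one x;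
  PA_ge0 : forall x : M, zero = x \/ lt zero x
}.

(* M is identified with its image under the inclusion [j]. *)
Record substructure (M K : structure) (j : M -> K) : Prop := {
  sub_inj : injective j;
  sub_zero : j zero = zero;
  sub_one : j one = one;
  sub_add : forall x y : M, j (add x y) = add (j x) (j y);
  sub_mul : forall x y : M, j (mul x y) = mul (j x) (j y);
  sub_lt : forall x y : M, lt x y <-> lt (j x) (j y)
}.

Definition elementary_for (Gamma : formula -> Prop) (M K : structure)
    (j : M -> K) : Prop :=
  substructure j /\
  forall phi, Gamma phi ->
  forall e : nat -> M, sat e phi <-> sat (fun i => j (e i)) phi.

Definition cofinal_extension (M K : structure) (j : M -> K) : Prop :=
  substructure j /\ forall a : K, exists b : M, lt a (j b).

Definition tuple_lt (M : structure) (k : nat) (x u : k.-tuple M) : Prop :=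
  forall i : 'I_k, lt (tnth x i) (tnth u i).

(* phi(x, y, z) holds in M: the variables 0, ..., l - 1 of phi stand for y, the
   next k ones for x, and the remaining ones for the parameters z. As phi has
   finitely many free variables, quantifying over assignments z amounts to
   quantifying over finite tuples. *)
Definition sat3 (M : structure) (k l : nat) (phi : formula)
    (x : k.-tuple M) (y : l.-tuple M) (z : nat -> M) : Prop :=
  sat (cat_env y (cat_env x z)) phi.

Definition Coll (Gamma : formula -> Prop) (M : structure) : Prop :=
  forall phi, Gamma phi ->
  forall (k l : nat) (z : nat -> M) (u : k.-tuple M),
    (forall x : k.-tuple M, tuple_lt x u ->
       exists y : l.-tuple M, sat3 phi x y z) ->
    exists v : l.-tuple M, forall x : k.-tuple M, tuple_lt x u ->
      exists y : l.-tuple M, tuple_lt y v /\ sat3 phi x y z.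

Definition Coll_s (Gamma : formula -> Prop) (M : structure) : Prop :=
  forall phi, Gamma phi ->
  forall (k l : nat) (z : nat -> M) (u : k.-tuple M),
    exists v : l.-tuple M, forall x : k.-tuple M, tuple_lt x u ->
      (exists y : l.-tuple M, sat3 phi x y z) ->
      exists y : l.-tuple M, tuple_lt y v /\ sat3 phi x y z.

(* Main.v *)
(* If M satisfies Coll_s(Sigma_n), then on any domain bounded by an element of
   M, every Sigma_n formula is equivalent, in M and in K at once, to a Delta0
   formula with parameters from M. For an existential formula, strong
   collection in M gives a bound v in M on the witnesses. To see that v also
   works in K, put a given witness in K below some d in M by cofinality: on the
   domain bounded by d, the matrix is Delta0 by induction, so the assertion that
   witnesses below d can be replaced by witnesses below v is a Delta0 statement,
   and it passes from M to K.
   The same transfer of bounds proves Coll_s(Sigma_{n+1}) in K. For the first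
   part, Coll(Sigma_{n+1}) in M implies Coll_s(Sigma_n) when n > 0 (when n = 0
   there is nothing to reduce), so the Sigma_n matrix of a Sigma_{n+2} formula
   may be treated as Delta0, and the classical argument for n = 0 applies. *)
From Stdlib Require Import Classical FunctionalExtensionality.
Require Import Defs.
From mathcomp Require Import all_boot.

Set Implicit Arguments.
Unset Strict Implicit.
Unset Printing Implicit Defensive.

(** * Concatenated assignments *)

Lemma cat_env_nil (T : Type) (e : nat -> T) : cat_env [::] e = e.
Proof.
by apply: functional_extensionality => i; rewrite /cat_env nth_nil subn0.
Qed.

Lemma cat_env_cat (T : Type) (t s : seq T) (e : nat -> T) :
  cat_env t (cat_env s e) = cat_env (t ++ s) e.
Proof.
apply: functional_extensionality => i; rewrite /cat_env nth_cat size_cat subnDA.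
by case: ltnP => hi; [apply: set_nth_default | rewrite nth_default].
Qed.

Lemma cat_env_drop (T : Type) (s : seq T) (e : nat -> T) m i :
  size s = m -> cat_env s e (m + i) = e i.
Proof.
by move=> <-; rewrite /cat_env nth_default ?leq_addr // addKn.
Qed.

Lemma cat_env_drop_fun (T : Type) (s : seq T) (e : nat -> T) m :
  size s = m -> (fun i => cat_env s e (m + i)) = e.
Proof.
by move=> hs; apply: functional_extensionality => i; apply: cat_env_drop.
Qed.

Lemma map_cat_env (T U : Type) (h : T -> U) (s : seq T) (e : nat -> T) :
  (fun i => h (cat_env s e i)) = cat_env (map h s) (fun i => h (e i)).
Proof.
apply: functional_extensionality => i; rewrite /cat_env size_map.
by move: (e _) => d; elim: s i => [|a s IH] [|i] /=.
Qed.

(** * Prenex operations on formulas *)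

Definition up (f : nat -> nat) (i : nat) : nat :=
  if i is i'.+1 then (f i').+1 else 0.

Fixpoint trename (f : nat -> nat) (t : term) : term :=
  match t with
  | Var i => Var (f i)
  | Zero => Zero
  | One => One
  | Add s t => Add (trename f s) (trename f t)
  | Mul s t => Mul (trename f s) (trename f t)
  end.

Fixpoint rename (f : nat -> nat) (phi : formula) : formula :=
  match phi with
  | Eq s t => Eq (trename f s) (trename f t)
  | Lt s t => Lt (trename f s) (trename f t)
  | Not phi => Not (rename f phi)
  | And phi psi => And (rename f phi) (rename f psi)
  | Or phi psi => Or (rename f phi) (rename f psi)
  | Imp phi psi => Imp (rename f phi) (rename f psi)
  | All phi => All (rename (up f) phi)
  | Ex phi => Ex (rename (up f) phi)
  end.

Lemma eval_trename (N : structure) f (e : nat -> N) t :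
  eval e (trename f t) = eval (fun i => e (f i)) t.
Proof. by elim: t => //= s -> t ->. Qed.

Lemma cat_env_up (T : Type) (a : T) f (e : nat -> T) :
  (fun i => cat_env [:: a] e (up f i)) = cat_env [:: a] (fun i => e (f i)).
Proof.
by apply: functional_extensionality => -[|i] //; rewrite /cat_env /= !nth_nil !subn1.
Qed.

Lemma sat_rename (N : structure) f (e : nat -> N) phi :
  sat e (rename f phi) <-> sat (fun i => e (f i)) phi.
Proof.
elim: phi f e => /=.
- by move=> s t f e; rewrite !eval_trename.
- by move=> s t f e; rewrite !eval_trename.
- by move=> phi IH f e; have := IH f e; tauto.
- by move=> phi IH1 psi IH2 f e; have := IH1 f e; have := IH2 f e; tauto.
- by move=> phi IH1 psi IH2 f e; have := IH1 f e; have := IH2 f e; tauto.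
- by move=> phi IH1 psi IH2 f e; have := IH1 f e; have := IH2 f e; tauto.
- by move=> phi IH f e; split=> H a; have := H a; rewrite IH cat_env_up.
- by move=> phi IH f e; split=> -[a H]; exists a; move: H; rewrite IH cat_env_up.
Qed.

Lemma trename_up_shift f t : trename (up f) (shift t) = shift (trename f t).
Proof. by elim: t => //= s -> t ->. Qed.

Lemma Delta0_rename f phi : Delta0 phi -> Delta0 (rename f phi).
Proof.
move=> h; elim: h f => //=; try by [constructor | move=> *; constructor; auto].
- by move=> t psi _ IH f; rewrite trename_up_shift; apply: Delta0_bAll.
- by move=> t psi _ IH f; rewrite trename_up_shift; apply: Delta0_bEx.
Qed.

Lemma Sigma_Ex_inv n phi :
  Sigma n.+1 phi -> exists k pi, Pi n pi /\ phi = iter k Ex pi.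
Proof. by move=> h; inversion h as [|n' k pi hpi]; exists k, pi. Qed.

Lemma Pi_All_inv n phi :
  Pi n.+1 phi -> exists k sigma, Sigma n sigma /\ phi = iter k All sigma.
Proof. by move=> h; inversion h as [|n' k pi hpi]; exists k, pi. Qed.

Lemma Sigma0_inv phi : Sigma 0 phi -> Delta0 phi.
Proof. by move=> h; inversion h. Qed.

Lemma Pi0_inv phi : Pi 0 phi -> Delta0 phi.
Proof. by move=> h; inversion h. Qed.

Lemma Pi_SigmaS n phi : Pi n phi -> Sigma n.+1 phi.
Proof. exact: (@Sigma_S n 0). Qed.

(** The two inclusions are proved together because each climbs one level by lifting the matrix with
    the other. At level 0 an empty quantifier block is added. *)
Lemma SigmaS_PiS n : (forall phi, Sigma n phi -> Sigma n.+1 phi) /\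
  (forall phi, Pi n phi -> Pi n.+1 phi).
Proof.
elim: n => [|n [IHs IHp]]; split=> phi.
- by move/Sigma0_inv => h; apply: (@Sigma_S 0 0); constructor.
- by move/Pi0_inv => h; apply: (@Pi_S 0 0); constructor.
- by case/Sigma_Ex_inv => k [pi [/IHp h ->]]; constructor.
- by case/Pi_All_inv => k [pi [/IHs h ->]]; constructor.
Qed.

Lemma Sigma_mono n phi : Sigma n phi -> Sigma n.+1 phi.
Proof. exact: (SigmaS_PiS n).1. Qed.

Lemma Pi_iter_All n k phi : Pi n.+1 phi -> Pi n.+1 (iter k All phi).
Proof. by case/Pi_All_inv => l [sigma [h ->]]; rewrite -iterD; constructor. Qed.

Lemma rename_iter_Ex f k phi :
  rename f (iter k Ex phi) = iter k Ex (rename (iter k up f) phi).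
Proof. by elim: k f => //= k IH f; rewrite IH -iterSr. Qed.

Lemma rename_iter_All f k phi :
  rename f (iter k All phi) = iter k All (rename (iter k up f) phi).
Proof. by elim: k f => //= k IH f; rewrite IH -iterSr. Qed.

Lemma Sigma_Pi_rename n :
  (forall f phi, Sigma n phi -> Sigma n (rename f phi)) /\
  (forall f phi, Pi n phi -> Pi n (rename f phi)).
Proof.
elim: n => [|n [IHs IHp]]; split=> f phi.
- by move/Sigma0_inv => h; constructor; apply: Delta0_rename.
- by move/Pi0_inv => h; constructor; apply: Delta0_rename.
- case/Sigma_Ex_inv => k [pi [h ->]]; rewrite rename_iter_Ex.
  by constructor; apply: IHp.
- case/Pi_All_inv => k [pi [h ->]]; rewrite rename_iter_All.
  by constructor; apply: IHs.
Qed.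

Lemma sat_iter_Ex (N : structure) k (e : nat -> N) phi :
  sat e (iter k Ex phi) <-> exists s, size s = k /\ sat (cat_env s e) phi.
Proof.
elim: k e => [|k IH] e /=.
  split=> [h | [s [/size0nil ->]]]; last by rewrite cat_env_nil.
  by exists [::]; rewrite cat_env_nil.
split=> [[a /IH [s [hs h]]] | [s]].
  exists (rcons s a); rewrite size_rcons hs -cats1; split=> //.
  by rewrite -cat_env_cat.
case/lastP: s => [[]//|s a]; rewrite size_rcons -cats1 -cat_env_cat.
by move=> [[hs] h]; exists a; apply/IH; exists s.
Qed.

Lemma sat_iter_All (N : structure) k (e : nat -> N) phi :
  sat e (iter k All phi) <-> forall s, size s = k -> sat (cat_env s e) phi.
Proof.
elim: k e => [|k IH] e /=.
  split=> [h s /size0nil -> | h]; first by rewrite cat_env_nil.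
  by have := h [::] erefl; rewrite cat_env_nil.
split=> [h s | h a].
  case/lastP: s => [//|s a]; rewrite size_rcons -cats1 -cat_env_cat => -[hs].
  exact: (IH _).1 (h a) s hs.
apply/IH => s hs; have := h (rcons s a).
by rewrite size_rcons hs -cats1 -cat_env_cat; apply.
Qed.

Definition equiv (phi psi : formula) : Prop :=
  forall (N : structure) (e : nat -> N), sat e phi <-> sat e psi.

(** The classes are syntactic, so a negated prenex formula is only equivalent to a member of the
    dual class, obtained by flipping every block. *)
Lemma Sigma_Pi_Not n :
  (forall phi, Sigma n phi -> exists2 psi, Pi n psi & equiv psi (Not phi)) /\
  (forall phi, Pi n phi -> exists2 psi, Sigma n psi & equiv psi (Not phi)).
Proof.
elim: n => [|n [IHs IHp]]; split=> phi.
- by move/Sigma0_inv => h; exists (Not phi) => //; do 2! constructor.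
- by move/Pi0_inv => h; exists (Not phi) => //; do 2! constructor.
- case/Sigma_Ex_inv => k [pi [/IHp [sigma hs eqs] ->]].
  exists (iter k All sigma) => [|N e]; first by constructor.
  rewrite /= sat_iter_All sat_iter_Ex; split.
    by move=> h [s [hsz hsat]]; have := h s hsz; rewrite eqs.
  by move=> h s hsz; apply/eqs => /= hsat; apply: h; exists s.
- case/Pi_All_inv => k [sigma [/IHs [pi hp eqp] ->]].
  exists (iter k Ex pi) => [|N e]; first by constructor.
  rewrite /= sat_iter_All sat_iter_Ex; split.
    by move=> [s [hsz]] /eqp /= hsat h; apply/hsat/h.
  move=> h; apply: NNPP => hn; apply: h => s hsz; apply: NNPP => hsat.
  by apply: hn; exists s; split=> //; apply/eqp.
Qed.

(* [ren m g] applies [g] to the variables from [m] on, counted from [m]. *)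
Definition ren (m : nat) (g : nat -> nat) (i : nat) : nat :=
  if i < m then i else m + g (i - m).

Lemma sat_rename_ren (N : structure) m g (s : seq N) (e : nat -> N) phi :
  size s = m ->
  sat (cat_env s e) (rename (ren m g) phi) <->
  sat (cat_env s (fun i => e (g i))) phi.
Proof.
move=> hs; rewrite sat_rename.
suff -> : (fun i => cat_env s e (ren m g i)) = cat_env s (fun i => e (g i)) by [].
apply: functional_extensionality => i; rewrite /ren; case: ltnP => hi.
  by rewrite /cat_env; apply: set_nth_default; rewrite hs.
by rewrite cat_env_drop // -{2}(subnKC hi) cat_env_drop.
Qed.

Lemma sat_rename_insert (N : structure) m k (s t : seq N) (e : nat -> N) phi :
  size s = m -> size t = k ->
  sat (cat_env (s ++ t) e) (rename (ren m (addn k)) phi) <->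
  sat (cat_env s e) phi.
Proof.
by move=> hs ht; rewrite -cat_env_cat sat_rename_ren // cat_env_drop_fun.
Qed.

Lemma sat_rename_add (N : structure) m (s : seq N) (e : nat -> N) phi :
  size s = m -> sat (cat_env s e) (rename (addn m) phi) <-> sat e phi.
Proof.
by move=> hs; rewrite sat_rename cat_env_drop_fun.
Qed.

(** In the merged block the first [k] variables belong to [phi] and the next [l] to [psi]; each
    disjunct is renamed to skip the block of the other. *)
Lemma Or_iter_Ex k l phi psi :
  equiv (iter (k + l) Ex (Or (rename (ren k (addn l)) phi) (rename (addn k) psi)))
        (Or (iter k Ex phi) (iter l Ex psi)).
Proof.
move=> N e /=; rewrite !sat_iter_Ex; split.
  case=> w [hw /=]; rewrite -(cat_take_drop k w).
  have hs : size (take k w) = k by rewrite size_takel // hw leq_addr.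
  have ht : size (drop k w) = l by rewrite size_drop hw addKn.
  rewrite sat_rename_insert // -cat_env_cat sat_rename_add //.
  by case=> h; [left; exists (take k w) | right; exists (drop k w)].
case=> [[s [hs h]] | [t [ht h]]].
  (* The block of the other disjunct is padded with [zero], whose value does not matter. *)
  exists (s ++ nseq l zero); rewrite size_cat size_nseq hs; split=> //=; left.
  by apply/sat_rename_insert; rewrite ?size_nseq.
exists (nseq k zero ++ t); rewrite size_cat size_nseq ht; split=> //=; right.
by rewrite -cat_env_cat; apply/sat_rename_add; rewrite ?size_nseq.
Qed.

Lemma Or_iter_All k l phi psi :
  equiv (iter (k + l) All (Or (rename (ren k (addn l)) phi) (rename (addn k) psi)))
        (Or (iter k All phi) (iter l All psi)).
Proof.
move=> N e /=; rewrite !sat_iter_All; split.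
  (* If both disjuncts failed, their counterexamples, concatenated, would refute the merged
     block. *)
  move=> h; apply: NNPP => /not_or_and [/not_all_ex_not [s hs] /not_all_ex_not [t ht]].
  have {hs} [hs hphi] := imply_to_and _ _ hs.
  have {ht} [ht hpsi] := imply_to_and _ _ ht.
  have := h (s ++ t); rewrite size_cat hs ht => /(_ erefl) /=.
  by rewrite sat_rename_insert // -cat_env_cat sat_rename_add //; case.
move=> h w hw; rewrite -(cat_take_drop k w) /=.
have hs : size (take k w) = k by rewrite size_takel // hw leq_addr.
have ht : size (drop k w) = l by rewrite size_drop hw addKn.
rewrite sat_rename_insert // -cat_env_cat sat_rename_add //.
by case: h => h; [left | right]; apply: h.
Qed.

(** Merging the outer blocks leaves a disjunction of matrices one level down, which the dual half of
    the induction hypothesis handles. *)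
Lemma Sigma_Pi_Or n :
  (forall phi psi, Sigma n phi -> Sigma n psi ->
     exists2 chi, Sigma n chi & equiv chi (Or phi psi)) /\
  (forall phi psi, Pi n phi -> Pi n psi ->
     exists2 chi, Pi n chi & equiv chi (Or phi psi)).
Proof.
elim: n => [|n [IHs IHp]]; split=> phi psi.
- by move=> /Sigma0_inv h1 /Sigma0_inv h2; exists (Or phi psi) => //; do 2! constructor.
- by move=> /Pi0_inv h1 /Pi0_inv h2; exists (Or phi psi) => //; do 2! constructor.
- case/Sigma_Ex_inv => k [p [hp ->]] /Sigma_Ex_inv [l [q [hq ->]]].
  have [] := IHp (rename (ren k (addn l)) p) (rename (addn k) q);
    try exact: (Sigma_Pi_rename n).2.
  move=> r hr eqr; exists (iter (k + l) Ex r) => [|N e]; first by constructor.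
  rewrite -Or_iter_Ex !sat_iter_Ex.
  by split=> -[s [hs h]]; exists s; split=> //; apply/eqr.
- case/Pi_All_inv => k [p [hp ->]] /Pi_All_inv [l [q [hq ->]]].
  have [] := IHs (rename (ren k (addn l)) p) (rename (addn k) q);
    try exact: (Sigma_Pi_rename n).1.
  move=> r hr eqr; exists (iter (k + l) All r) => [|N e]; first by constructor.
  rewrite -Or_iter_All !sat_iter_All.
  by split=> h s hs; apply/eqr; apply: h.
Qed.

(* The instance of collection used is for [phi(y) \/ forall y', ~ phi(y')],
   which some [y] always satisfies. *)
Lemma Coll_Coll_s n (N : structure) :
  Coll (Sigma n.+2) N -> Coll_s (Sigma n.+1) N.
Proof.
move=> hC phi hphi k l z u.
have [nu hnu eqnu] := (Sigma_Pi_Not n.+1).1 phi hphi.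
(* The inner block [y'] takes the first [l] variables and pushes [y] to the next [l]; the renaming
   makes [nu] skip [y]. *)
have hall : Sigma n.+2 (iter l All (rename (ren l (addn l)) nu)).
  by apply/Pi_SigmaS/Pi_iter_All/(Sigma_Pi_rename _).2.
have [chi hchi eqchi] := (Sigma_Pi_Or _).1 _ _ (Sigma_mono hphi) hall.
have satchi (x : k.-tuple N) (y : l.-tuple N) : sat3 chi x y z <->
    sat3 phi x y z \/ forall y' : l.-tuple N, ~ sat3 phi x y' z.
  rewrite /sat3 eqchi /= sat_iter_All.
  suff E : (forall s, size s = l -> sat (cat_env s (cat_env y (cat_env x z)))
               (rename (ren l (addn l)) nu)) <->
      forall y' : l.-tuple N, ~ sat3 phi x y' z by tauto.
  split=> [h y' | h s hs].
    have := h y' (size_tuple y').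
    by rewrite cat_env_cat sat_rename_insert ?size_tuple // eqnu.
  rewrite cat_env_cat sat_rename_insert ?size_tuple // eqnu.
  by have := h (tcast hs (in_tuple s)); rewrite /sat3 val_tcast.
have [x hx | v hv] := hC chi hchi k l z u.
  have [[y hy] | hn] := classic (exists y : l.-tuple N, sat3 phi x y z).
    by exists y; apply/satchi; left.
  exists (nseq_tuple l zero); apply/satchi; right=> y hy; apply: hn.
  by exists y.
exists v => x hx [y0 hy0]; have [y [hyv /satchi [hy | hn]]] := hv x hx.
  by exists y.
by case: (hn y0).
Qed.

(** * Dependence of truth on finitely many variables *)

Fixpoint tvars (t : term) : nat :=
  match t with
  | Var i => i.+1
  | Zero | One => 0
  | Add s t | Mul s t => maxn (tvars s) (tvars t)
  end.

(* All free variables of [phi] are below [vars phi]. *)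
Fixpoint vars (phi : formula) : nat :=
  match phi with
  | Eq s t | Lt s t => maxn (tvars s) (tvars t)
  | Not phi => vars phi
  | And phi psi | Or phi psi | Imp phi psi => maxn (vars phi) (vars psi)
  | All phi | Ex phi => (vars phi).-1
  end.

Lemma eval_agree (N : structure) (e e' : nat -> N) t :
  (forall i, i < tvars t -> e i = e' i) -> eval e t = eval e' t.
Proof.
elim: t => //= [i -> //|s IHs t IHt h|s IHs t IHt h];
  by rewrite IHs ?IHt // => i hi; apply: h; rewrite leq_max hi ?orbT.
Qed.

Lemma sat_agree (N : structure) (e e' : nat -> N) phi :
  (forall i, i < vars phi -> e i = e' i) -> sat e phi <-> sat e' phi.
Proof.
elim: phi e e' => /=.
1,2: by move=> s t e e' h; rewrite (@eval_agree _ e e') ?(@eval_agree _ e e' t) //;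
  move=> i hi; apply: h; rewrite leq_max hi ?orbT.
1: by move=> phi IH e e' /IH; tauto.
1-3: by move=> phi IH1 psi IH2 e e' h; rewrite (IH1 e e') ?(IH2 e e') //;
  move=> i hi; apply: h; rewrite leq_max hi ?orbT.
all: move=> phi IH e e' h.
all: have E a : sat (cat_env [:: a] e) phi <-> sat (cat_env [:: a] e') phi
  by apply: IH => -[|i] // hi; rewrite /cat_env /= !nth_nil subn1 h //;
     case: (vars phi) hi.
- by split=> H a; apply/E.
- by split=> -[a H]; exists a; apply/E.
Qed.

(** * Bounded tuples *)

(** A single bound for all entries replaces tuples of bounds, and plain sequences can be
    concatenated without casts. *)
Fixpoint below (N : structure) (b : N) (s : seq N) : Prop :=
  if s is a :: s' then lt a b /\ below b s' else True.

Lemma below_cat (N : structure) (b : N) s t :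
  below b (s ++ t) <-> below b s /\ below b t.
Proof. by elim: s => /= [|a s ->]; tauto. Qed.

Lemma belowP (N : structure) (b : N) k (x : k.-tuple N) :
  below b x <-> tuple_lt x (nseq_tuple k b).
Proof.
suff E (s : seq N) : below b s <-> forall i, i < size s -> lt (nth b s i) b.
  rewrite E size_tuple; split=> h i.
    by rewrite !(tnth_nth b) /= nth_nseq ltn_ord; apply/h.
  move=> hi; have := h (Ordinal hi).
  by rewrite !(tnth_nth b) /= nth_nseq hi.
elim: s => //= a s ->; split=> [[ha h] [|i] //| h]; first exact: h.
by split=> [|i hi]; [exact: (h 0) | exact: (h i.+1)].
Qed.

Definition le (N : structure) (x y : N) : Prop := x = y \/ lt x y.

Lemma le_directed (N : structure) (hN : PAminus N) (x y : N) :
  exists z, le x z /\ le y z.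
Proof.
have [h|[h|h]] := PA_lt_total hN x y.
- by exists y; split; [right | left].
- by exists y; split; left.
- by exists x; split; [left | right].
Qed.

Lemma le_trans (N : structure) (hN : PAminus N) (x y z : N) :
  le x y -> le y z -> le x z.
Proof.
move=> [-> // | hxy] [<- | hyz]; right => //.
exact: PA_lt_trans hN _ _ _ hxy hyz.
Qed.

Lemma below_le (N : structure) (hN : PAminus N) (b c : N) s :
  le b c -> below b s -> below c s.
Proof.
move=> [-> // | hbc]; elim: s => //= a s IH [ha /IH hs]; split=> //.
exact: PA_lt_trans hN _ _ _ ha hbc.
Qed.

Lemma below_cat_le (N : structure) (hN : PAminus N) (b c d : N) s t :
  le b d -> le c d -> below b s -> below c t -> below d (s ++ t).
Proof.
move=> hb hc hs ht; apply/below_cat.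
by split; [apply: below_le hb hs | apply: below_le hc ht].
Qed.

(** * Bounds and collection along a cofinal extension *)

Section CofinalExtension.

Variables (M K : structure) (j : M -> K).
Hypotheses (hM : PAminus M) (hK : PAminus K).
Hypotheses (hcof : cofinal_extension j) (hD0 : elementary_for Delta0 j).

Let jlt (x y : M) : lt x y <-> lt (j x) (j y).
Proof. exact: sub_lt hcof.1 x y. Qed.

Lemma le_sub (x y : M) : le x y -> le (j x) (j y).
Proof. by case=> [-> | /jlt h]; [left | right]. Qed.

Lemma below_map (b : M) s : below (j b) (map j s) <-> below b s.
Proof. by elim: s => //= a s ->; rewrite jlt. Qed.

(** Cofinality bounds each entry by an element of M, and linearity of M merges finitely many such
    bounds. *)
Lemma exists_below (s : seq K) : exists b : M, below (j b) s.
Proof.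
elim: s => [|a s [b hb]]; first by exists zero.
have [c hc] := hcof.2 a; have [d [hbd hcd]] := le_directed hM b c.
exists d; split; last exact: below_le (le_sub hbd) hb.
by case: (le_sub hcd) => [<- // | h]; apply: PA_lt_trans hK _ _ _ hc h.
Qed.

Lemma exists_below_base (s : seq M) : exists b, below b s.
Proof. by have [b /below_map hb] := exists_below (map j s); exists b. Qed.

Lemma tuple_lt_below (l : nat) (y v : l.-tuple M) (b : M) :
  below b v -> tuple_lt y v -> below b y.
Proof.
move=> /belowP hv hy; apply/belowP => i.
exact: PA_lt_trans hM _ _ _ (hy i) (hv i).
Qed.

(** The domain is bounded by the constant tuple of [b], and the tuple of bounds that collection
    returns is replaced by one strict bound on its entries. *)
Lemma Coll_below Gamma phi : Coll Gamma M -> Gamma phi ->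
  forall m l (p : nat -> M) (b : M),
  (forall s, size s = m -> below b s ->
     exists t, size t = l /\ sat (cat_env (t ++ s) p) phi) ->
  exists v, forall s, size s = m -> below b s ->
     exists t, [/\ size t = l, below v t & sat (cat_env (t ++ s) p) phi].
Proof.
move=> hC hphi m l p b h.
have [x /belowP hx | v hv] := hC phi hphi m l p (nseq_tuple m b).
  have [t [ht hsat]] := h x (size_tuple x) hx.
  by exists (tcast ht (in_tuple t)); rewrite /sat3 val_tcast cat_env_cat.
have [c hc] := exists_below_base v; exists c => s hs hb.
have [|y [hyv hsat]] := hv (tcast hs (in_tuple s)).
  by apply/belowP; rewrite val_tcast.
exists y; split; rewrite ?size_tuple //; first exact: tuple_lt_below hyv.
by move: hsat; rewrite /sat3 val_tcast cat_env_cat.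
Qed.

(** This is the conclusion of strong collection with one bound on each side, stated for any
    structure so that it can pass from M to K. *)
Definition bounded_witnesses (N : structure) phi m l (p : nat -> N) (b v : N) :=
  forall s t, size s = m -> below b s ->
  size t = l -> sat (cat_env (t ++ s) p) phi ->
  exists t', [/\ size t' = l, below v t' & sat (cat_env (t' ++ s) p) phi].

Lemma Coll_s_below Gamma phi : Coll_s Gamma M -> Gamma phi ->
  forall m l (p : nat -> M) (b : M), exists v, bounded_witnesses phi m l p b v.
Proof.
move=> hC hphi m l p b.
have [v hv] := hC phi hphi m l p (nseq_tuple m b).
have [c hc] := exists_below_base v; exists c => s t hs hb ht h.
have [||y [hyv hsat]] := hv (tcast hs (in_tuple s)).
- by apply/belowP; rewrite val_tcast.
- by exists (tcast ht (in_tuple t)); rewrite /sat3 !val_tcast cat_env_cat.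
exists y; split; rewrite ?size_tuple //; first exact: tuple_lt_below hyv.
by move: hsat; rewrite /sat3 val_tcast cat_env_cat.
Qed.

(** * Reduction to bounded formulas on bounded domains *)

(* [P] and [Q] are the traces on M and on K of one Delta0 relation with
   parameters from M. *)
Definition D0 (m : nat) (P : seq M -> Prop) (Q : seq K -> Prop) : Prop :=
  exists psi p, [/\ Delta0 psi,
    forall s, size s = m -> (P s <-> sat (cat_env s p) psi) &
    forall s, size s = m -> (Q s <-> sat (cat_env s (fun i => j (p i))) psi)].

Lemma D0_ext m P Q P' Q' :
  (forall s, size s = m -> (P s <-> P' s)) ->
  (forall s, size s = m -> (Q s <-> Q' s)) -> D0 m P Q -> D0 m P' Q'.
Proof.
move=> eP eQ [psi [p [h hP hQ]]]; exists psi, p; split=> // s hs.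
- by rewrite -eP // hP.
- by rewrite -eQ // hQ.
Qed.

Lemma D0_Not m P Q : D0 m P Q -> D0 m (fun s => ~ P s) (fun s => ~ Q s).
Proof.
move=> [psi [p [h hP hQ]]]; exists (Not psi), p; split=> [|s hs|s hs] /=.
- by constructor.
- by rewrite hP.
- by rewrite hQ.
Qed.

Lemma D0_Imp m P1 Q1 P2 Q2 : D0 m P1 Q1 -> D0 m P2 Q2 ->
  D0 m (fun s => P1 s -> P2 s) (fun s => Q1 s -> Q2 s).
Proof.
move=> [psi1 [p1 [h1 hP1 hQ1]]] [psi2 [p2 [h2 hP2 hQ2]]].
(* The two parameter assignments are interleaved: even positions serve [psi1], odd ones [psi2]. *)
exists (Imp (rename (ren m double) psi1) (rename (ren m (fun i => i.*2.+1)) psi2)).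
have [p [E1 E2]] : exists p, (fun i => p i.*2) = p1 /\ (fun i => p i.*2.+1) = p2.
  exists (fun i => if odd i then p2 i./2 else p1 i./2).
  split; apply: functional_extensionality => i; rewrite /= odd_double ?doubleK //.
  by rewrite /= uphalf_double.
exists p; split=> [|s hs|s hs]; first by constructor; apply: Delta0_rename.
- by rewrite /= !sat_rename_ren // E1 E2 hP1 // hP2.
- by rewrite /= !sat_rename_ren // hQ1 // hQ2 // -E1 -E2.
Qed.

(** A bound must be a term, so [v] becomes a new first parameter, read as [Var m] behind the [m]
    entries of [s]; the renaming makes [psi] skip it. *)
Lemma sat_bEx_param (N : structure) m (s : seq N) (v : N) (p : nat -> N) psi :
  size s = m ->
  sat (cat_env s (cat_env [:: v] p)) (bEx (Var m) (rename (ren m.+1 (addn 1)) psi)) <->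
  exists a, lt a v /\ sat (cat_env (a :: s) p) psi.
Proof.
move=> hs; rewrite /=.
have E a : cat_env [:: a] (cat_env s (cat_env [:: v] p)) m.+1 = v.
  rewrite (@cat_env_drop _ [:: a] _ 1 m) //.
  by rewrite -{1}(addn0 m) cat_env_drop.
split=> -[a [ha h]]; exists a; move: ha h; rewrite E !cat_env_cat.
  by rewrite sat_rename_insert //= hs.
by rewrite sat_rename_insert //= hs.
Qed.

Lemma D0_bEx m (v : M) P Q : D0 m.+1 P Q ->
  D0 m (fun s => exists a, lt a v /\ P (a :: s))
       (fun s => exists a, lt a (j v) /\ Q (a :: s)).
Proof.
move=> [psi [p [h hP hQ]]].
exists (bEx (Var m) (rename (ren m.+1 (addn 1)) psi)), (cat_env [:: v] p).
split=> [|s hs|s hs]; first by constructor; apply: Delta0_rename.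
- rewrite sat_bEx_param //; split=> -[a [ha]] hp; exists a; split=> //.
    by rewrite -hP //= hs.
  by rewrite hP //= hs.
- rewrite map_cat_env sat_bEx_param //; split=> -[a [ha]] hq; exists a; split=> //.
    by rewrite -hQ //= hs.
  by rewrite hQ //= hs.
Qed.

Lemma D0_bEx_iter l m (v : M) P Q : D0 (l + m) P Q ->
  D0 m (fun s => exists t, [/\ size t = l, below v t & P (t ++ s)])
       (fun s => exists t, [/\ size t = l, below (j v) t & Q (t ++ s)]).
Proof.
have E (N : structure) (R : seq N -> Prop) (c : N) k s :
    (exists t, [/\ size t = k, below c t & exists a, lt a c /\ R (a :: t ++ s)]) <->
    exists t, [/\ size t = k.+1, below c t & R (t ++ s)].
  split=> [[t [ht hb [a [ha h]]]] | [[|a t] [] //= [ht] [ha hb] h]].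
    by exists (a :: t); split=> //=; rewrite ht.
  by exists t; split=> //; exists a.
elim: l P Q => [|l IH] P Q h.
  apply: D0_ext h => s hs; split=> [h | [t [/size0nil -> _]] //]; by exists [::].
apply: D0_ext (IH _ _ (@D0_bEx (l + m) v _ _ h)) => s hs; exact: E.
Qed.

(** A counterexample in K below [j b] makes a bounded existential statement with parameters from M
    true in K, hence in M by Delta0-elementarity. *)
Lemma D0_transfer m (b : M) P Q : D0 m P Q ->
  (forall s, size s = m -> below b s -> P s) ->
  forall s, size s = m -> below (j b) s -> Q s.
Proof.
move=> h hP s hs hb; apply: NNPP => hQ.
(* All [m] variables get bounded, so the resulting relation is evaluated at the empty sequence. *)
have := D0_Not h; rewrite -{1}(addn0 m) => /(D0_bEx_iter b) [psi [p [hpsi eP eQ]]].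
have [|t [ht htb]] := (eP [::] erefl).2.
  rewrite cat_env_nil; apply/(hD0.2 _ hpsi).
  by rewrite -[X in sat X _]cat_env_nil -eQ //; exists s; rewrite cats0.
by rewrite cats0; apply; apply: hP.
Qed.

(* On each bounded domain, [phi] is equivalent to a Delta0 formula with
   parameters from M, the same one in M and in K. *)
Definition reducible (phi : formula) : Prop :=
  forall m (b : M) (p : nat -> M), exists P Q, [/\ D0 m P Q,
    forall s, size s = m -> below b s -> (sat (cat_env s p) phi <-> P s) &
    forall s, size s = m -> below (j b) s ->
      (sat (cat_env s (fun i => j (p i))) phi <-> Q s)].

Lemma reducible_Delta0 phi : Delta0 phi -> reducible phi.
Proof.
move=> h m b p; exists (fun s => sat (cat_env s p) phi).
exists (fun s => sat (cat_env s (fun i => j (p i))) phi).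
by split=> //; exists phi, p.
Qed.

Lemma reducible_Not phi psi : equiv psi (Not phi) -> reducible psi -> reducible phi.
Proof.
move=> e r m b p; have [P [Q [h hP hQ]]] := r m b p.
exists (fun s => ~ P s), (fun s => ~ Q s); split=> [|s hs hb|s hs hb].
- exact: D0_Not.
- by rewrite -hP // e /=; split; [tauto | apply: NNPP].
- by rewrite -hQ // e /=; split; [tauto | apply: NNPP].
Qed.

Lemma bounded_witnesses_transfer phi m l (p : nat -> M) (b v : M) :
  reducible phi -> bounded_witnesses phi m l p b v ->
  bounded_witnesses phi m l (fun i => j (p i)) (j b) (j v).
Proof.
move=> r hw s t hs hb ht hsat.
have [c hc] := exists_below t.
have [c' [hbc' hcc']] := le_directed hM b c.
(* [d] dominates the domain bound, the given witness and the candidate bound [v], so a single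
   reduction of [phi] covers all tuples involved. *)
have [d [hc'd hvd]] := le_directed hM c' v.
have hbd := le_trans hM hbc' hc'd; have hcd := le_trans hM hcc' hc'd.
have [P [Q [hD hP hQ]]] := r (l + m) d p.
(* The statement transferred is: if some [t] below [d] satisfies the reduced formula, then so does
   some [t] below [v]. *)
have [s' hs' hb' [t' [ht' hd' hp]] | | t' [ht' hv' hq]] :=
  D0_transfer (D0_Imp (D0_bEx_iter d hD) (D0_bEx_iter v hD)) _ hs hb.
- have [|t'' [ht'' hv'' h'']] := hw s' t' hs' hb' ht'.
    apply/hP; rewrite ?size_cat ?ht' ?hs' //.
    by apply: below_cat_le (or_introl erefl) hbd _ _.
  exists t''; split=> //; apply/hP; rewrite ?size_cat ?ht'' ?hs' //.
  exact: below_cat_le hvd hbd _ _.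
- exists t; split=> //; first exact: below_le (le_sub hcd) hc.
  apply/hQ; rewrite ?size_cat ?ht ?hs //.
  exact: below_cat_le (le_sub hcd) (le_sub hbd) _ _.
- exists t'; split=> //; apply/hQ; rewrite ?size_cat ?ht' ?hs //.
  exact: below_cat_le (le_sub hvd) (le_sub hbd) _ _.
Qed.

(** The bound [v] found in M also works in K, so in both structures the block may be bounded by
    [v]. *)
Lemma reducible_iter_Ex phi l : reducible phi ->
  (forall m (p : nat -> M) b, exists v, bounded_witnesses phi m l p b v) ->
  reducible (iter l Ex phi).
Proof.
move=> r hw m b p; have [v hv] := hw m p b.
have hvK := bounded_witnesses_transfer r hv.
have [d [hbd hvd]] := le_directed hM b v.
have [P [Q [hD hP hQ]]] := r (l + m) d p.
exists (fun s => exists t, [/\ size t = l, below v t & P (t ++ s)]).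
exists (fun s => exists t, [/\ size t = l, below (j v) t & Q (t ++ s)]).
split; first exact: D0_bEx_iter.
- move=> s hs hb; rewrite sat_iter_Ex; split=> [[t [ht h]] | [t [ht htv h]]].
    rewrite cat_env_cat in h; have [t' [ht' hb' h']] := hv s t hs hb ht h.
    exists t'; split=> //; apply/hP => //; first by rewrite size_cat ht' hs.
    exact: below_cat_le hvd hbd _ _.
  exists t; rewrite cat_env_cat; split=> //.
  apply/hP => //; first by rewrite size_cat ht hs.
  exact: below_cat_le hvd hbd _ _.
- move=> s hs hb; rewrite sat_iter_Ex; split=> [[t [ht h]] | [t [ht htv h]]].
    rewrite cat_env_cat in h; have [t' [ht' hb' h']] := hvK s t hs hb ht h.
    exists t'; split=> //; apply/hQ => //; first by rewrite size_cat ht' hs.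
    exact: below_cat_le (le_sub hvd) (le_sub hbd) _ _.
  exists t; rewrite cat_env_cat; split=> //.
  apply/hQ => //; first by rewrite size_cat ht hs.
  exact: below_cat_le (le_sub hvd) (le_sub hbd) _ _.
Qed.

(** The matrix is reduced through its negation, which is [Sigma n] up to equivalence. The witness
    bounds come from strong collection for the matrix itself, a [Sigma n.+1] formula with an empty
    block. *)
Lemma Coll_s_reducible n : Coll_s (Sigma n) M ->
  forall phi, Sigma n phi -> reducible phi.
Proof.
elim: n => [|n IH] hC phi; first by move/Sigma0_inv/reducible_Delta0.
case/Sigma_Ex_inv => k [pi [hpi ->]]; apply: reducible_iter_Ex.
  have [psi hpsi e] := (Sigma_Pi_Not n).2 pi hpi.
  apply: reducible_Not e _; apply: IH hpsi => chi hchi.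
  exact/hC/Sigma_mono.
by move=> m p b; apply: Coll_s_below hC _ _ _ _ _; apply: Pi_SigmaS.
Qed.

Lemma Coll_reducible n : Coll (Sigma n.+1) M ->
  forall phi, Sigma n phi -> reducible phi.
Proof.
case: n => [_ phi /Sigma0_inv /reducible_Delta0 // | n /Coll_Coll_s].
exact: Coll_s_reducible.
Qed.

(** * Elementarity and transfer of strong collection *)

Lemma Coll_elementary n :
  Coll (Sigma n.+1) M -> elementary_for (Sigma n.+2) j.
Proof.
move=> hC; split=> [|phi]; first exact: hcof.1.
case/Sigma_Ex_inv => k [pi [/Pi_All_inv [l [theta [hth ->]]] ->]] e.
have r := Coll_reducible hC hth.
rewrite !sat_iter_Ex; split=> -[s [hs]]; rewrite sat_iter_All => h.
  (* Upwards the witnesses are kept: any [t] in K lies below some [b] of M, and on that domain the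
     universal matrix is a bounded statement. *)
  exists (map j s); rewrite size_map sat_iter_All; split=> // t ht.
  rewrite -map_cat_env; have [b hb] := exists_below t.
  have [P [Q [hD hP hQ]]] := r l b (cat_env s e).
  apply/hQ => //; apply: D0_transfer hD _ t ht hb => t' ht' hb'.
  by apply/hP => //; apply: h.
(* Downwards, if M has no witness, every [s'] below [b] has a [t] refuting [theta]. Collection for
   [nu] bounds these [t] by [v], and this bounded statement transfers to K, where it contradicts the
   witness [s]. *)
have [b hb] := exists_below s; apply: NNPP => hn.
have [nu hnu enu] := (Sigma_Pi_Not n).1 theta hth.
have [s' hs' _ | v hv] := Coll_below (l := l) hC (Pi_SigmaS hnu) (m := k) (p := e) (b := b).
  apply: NNPP => hn'; apply: hn; exists s'; split=> //; apply/sat_iter_All => t ht.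
  rewrite cat_env_cat; apply: NNPP => hsat; apply: hn'; exists t; split=> //.
  exact/enu.
have [d [hbd hvd]] := le_directed hM b v.
have [P [Q [hD hP hQ]]] := r (l + k) d e.
have [|t [ht htv]] := D0_transfer (D0_bEx_iter v (D0_Not hD)) _ hs hb.
  move=> s' hs' hb'; have [t [ht htv /enu /= hsat]] := hv s' hs' hb'.
  exists t; split=> // /hP hp; apply: hsat; apply: hp.
    by rewrite size_cat ht hs'.
  exact: below_cat_le hvd hbd _ _.
apply; apply/hQ; rewrite ?size_cat ?ht ?hs //; last by rewrite -cat_env_cat; apply: h.
exact: below_cat_le (le_sub hvd) (le_sub hbd) _ _.
Qed.

Lemma Coll_s_transfer n : Coll_s (Sigma n) M -> Coll_s (Sigma n) K.
Proof.
move=> hC phi hphi k l z u.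
(* The parameters lie in K and need not come from M, so the finitely many that matter are appended
   to the domain tuple and bounded by [b] as well. *)
pose zs := mkseq z (vars phi).
have [b hb] := exists_below (u ++ zs).
have /below_cat [hbu hbz] := hb.
have [v hv] := Coll_s_below hC hphi (k + vars phi) l (fun=> zero) b.
have hvK := bounded_witnesses_transfer (Coll_s_reducible hC hphi) hv.
(* Every variable below [vars phi] falls inside [t ++ x ++ zs], so the default [j zero] is never
   read. *)
have E (t x : seq K) : sat (cat_env t (cat_env x z)) phi <->
    sat (cat_env (t ++ x ++ zs) (fun=> j zero)) phi.
  rewrite -!cat_env_cat !(cat_env_cat t); apply: sat_agree => i hi.
  rewrite /cat_env; case: (ltnP i (size (t ++ x))) => hi'.
    exact: set_nth_default.
  rewrite !(nth_default _ hi') nth_mkseq //.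
  exact: leq_ltn_trans (leq_subr _ _) hi.
exists (nseq_tuple l (j v)) => x hx [y /E hy].
have [|||t [ht htv h]] := hvK (x ++ zs) y _ _ _ hy.
- by rewrite size_cat size_tuple size_mkseq.
- apply/below_cat; split=> //; apply/belowP => i.
  by have/belowP := hbu => /(_ i); apply: PA_lt_trans hK _ _ _ (hx i).
- by rewrite size_tuple.
exists (tcast ht (in_tuple t)); split; first by apply/belowP; rewrite val_tcast.
by rewrite /sat3 val_tcast; apply/E.
Qed.

End CofinalExtension.

Theorem theorem3p4 (n : nat) (M K : structure) (j : M -> K)
    (hM : PAminus M) (hK : PAminus K)
    (hcof : cofinal_extension j) (hD0 : elementary_for Delta0 j) :
  (Coll (Sigma n.+1) M -> elementary_for (Sigma n.+2) j) /\
  (Coll_s (Sigma n.+1) M -> Coll_s (Sigma n.+1) K).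
Proof.
split; first exact: Coll_elementary.
exact: (Coll_s_transfer hM hK hcof hD0).
Qed.
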